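(* Let $(\mathfrak{g},\omega,j,\cdot)$ be a special Kähler Lie algebra which admits a complex and non-degenerate left ideal $I$, i.e. a left ideal $I$ of $(\mathfrak{g},\cdot)$ such that $j(I)=I$ and $\omega|_{I\times I}$ is non-degenerate. Then there exist two special Kähler Lie algebras $(\mathfrak{g}_1,\omega_1,j_1,\cdot_1)$ and $(\mathfrak{g}_2,\omega_2,j_2,\cdot_2)$ together with two Lie algebra representations $\theta:\mathfrak{g}_1\to \mathfrak{kl}(\mathfrak{g}_2,\omega_2,j_2)$ and $\rho:\mathfrak{g}_2\to \mathfrak{kl}(\mathfrak{g}_1,\omega_1,j_1)$ such that the special Kähler structure of $\mathfrak{g}$ can be obtained as the twisted cartesian product of $\mathfrak{g}_1$ and $\mathfrak{g}_2$ according to $(\theta,\rho)$.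
   Context: Special Kähler Lie algebra: a finite dimensional real Lie algebra $\mathfrak{g}$ with a triple $(\omega,j,\cdot)$ where $\omega$ is a non-degenerate skew-symmetric bilinear form that is a scalar 2-cocycle ($\omega([x,y],z)+\omega([y,z],x)+\omega([z,x],y)=0$); $j$ is an integrable complex structure ($j^2=-\mathrm{Id}$, $[jx,jy]-[x,y]=j[jx,y]+j[x,jy]$); $\cdot$ is a left symmetric product ($x\cdot(y\cdot z)-(x\cdot y)\cdot z=y\cdot(x\cdot z)-(y\cdot x)\cdot z$); and for all $x,y,z$: (i) $k(x,y)=\omega(x,j(y))$ is symmetric and non-degenerate; (ii) $[x,y]=x\cdot y-y\cdot x$; (iii) $\omega(x\cdot y,z)+\omega(y,x\cdot z)=0$; (iv) $j([x,y])=x\cdot j(y)-y\cdot j(x)$. A left ideal $I$ of $(\mathfrak{g},\cdot)$ is a subspace with $x\cdot a\in I$ for all $x\in\mathfrak{g}$, $a\in I$. $\mathfrak{kl}(V,\omega,J)$ is the Lie algebra of all $A\in\mathfrak{gl}(V)$ with $\omega(A(x),y)+\omega(x,A(y))=0$ and $AJ=JA$. Twisted cartesian product: given special Kähler Lie algebras $\mathfrak{g}_1,\mathfrak{g}_2$ with left multiplications $L_{x_1}(y_1)=x_1\cdot_1y_1$, $L'_{x_2}(y_2)=x_2\cdot_2y_2$, and Lie algebra representations $\theta:\mathfrak{g}_1\to \mathfrak{kl}(\mathfrak{g}_2,\omega_2,j_2)$, $\rho:\mathfrak{g}_2\to \mathfrak{kl}(\mathfrak{g}_1,\omega_1,j_1)$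 satisfying, for all $x_1\in\mathfrak{g}_1,x_2\in\mathfrak{g}_2$, $$L_{x_1}\circ\rho(x_2)-\rho(x_2)\circ L_{x_1}=\rho(\theta(x_1)(x_2))-L_{\rho(x_2)(x_1)},\qquad L'_{x_2}\circ\theta(x_1)-\theta(x_1)\circ L'_{x_2}=\theta(\rho(x_2)(x_1))-L'_{\theta(x_1)(x_2)},$$ it is the special Kähler Lie algebra on $\mathfrak{g}_1\oplus\mathfrak{g}_2$ with product $(x_1+x_2)\cdot(y_1+y_2)=L_{x_1}(y_1)+\rho(x_2)(y_1)+\theta(x_1)(y_2)+L'_{x_2}(y_2)$, Lie bracket the commutator of this product, symplectic form $\omega(x_1+x_2,y_1+y_2)=\omega_1(x_1,y_1)+\omega_2(x_2,y_2)$, and complex structure $j(x_1+x_2)=j_1(x_1)+j_2(x_2)$. *)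

(* Defs.v *)
From HB Require Import structures.
From mathcomp Require Import all_boot all_order all_algebra.
From mathcomp Require Import reals ring lra.

Set Implicit Arguments.
Unset Strict Implicit.
Unset Printing Implicit Defensive.

Import GRing.Theory.
Local Open Scope ring_scope.

Record lieAlgebra (R : realType) := LieAlgebra {
  lie_sort :> vectType R;
  lie_bracket : {bilinear lie_sort -> lie_sort -> lie_sort};
  lie_bracketxx : forall x, lie_bracket x x = 0;
  lie_jacobi : forall x y z,
    lie_bracket x (lie_bracket y z) + lie_bracket y (lie_bracket z x)
      + lie_bracket z (lie_bracket x y) = 0
}.

(* The restriction of b to I x I has trivial left radical; all forms below are
   symmetric or skew-symmetric, so the side does not matter. *)
Definition nondegenerate_on (R : realType) (V : vectType R)
    (b : V -> V -> R) (I : {vspace V}) : Prop :=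
  forall x, x \in I -> (forall y, y \in I -> b x y = 0) -> x = 0.

Section StructurePredicates.
Variables (R : realType) (g : lieAlgebra R).
Local Notation "[[ x , y ]]" := (lie_bracket g x y).

Definition scalar_2cocycle (omega : g -> g -> R) : Prop :=
  forall x y z,
    omega [[x, y]] z + omega [[y, z]] x + omega [[z, x]] y = 0.

Definition integrable_complex (j : 'End(g)) : Prop :=
  (forall x, j (j x) = - x) /\
  (forall x y, [[j x, j y]] - [[x, y]] = j [[j x, y]] + j [[x, j y]]).

Definition left_symmetric (p : g -> g -> g) : Prop :=
  forall x y z, p x (p y z) - p (p x y) z = p y (p x z) - p (p y x) z.

Record is_special_kahler (omega : {skew_symmetric g}) (j : 'End(g))
    (p : {bilinear g -> g -> g}) : Prop := IsSpecialKahler {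
  sk_omega_nondeg : nondegenerate_on omega fullv;
  sk_cocycle : scalar_2cocycle omega;
  sk_complex : integrable_complex j;
  sk_left_symmetric : left_symmetric p;
  sk_metric_sym : forall x y, omega x (j y) = omega y (j x);
  sk_metric_nondeg : nondegenerate_on (fun x y => omega x (j y)) fullv;
  sk_torsion_free : forall x y, [[x, y]] = p x y - p y x;
  sk_omega_parallel : forall x y z, omega (p x y) z + omega y (p x z) = 0;
  sk_special : forall x y, j [[x, y]] = p x (j y) - p y (j x)
}.

End StructurePredicates.

Record specialKahler (R : realType) := SpecialKahler {
  sk_lie :> lieAlgebra R;
  sk_omega : {skew_symmetric sk_lie};
  sk_j : 'End(sk_lie);
  sk_prod : {bilinear sk_lie -> sk_lie -> sk_lie};
  sk_axioms : is_special_kahler sk_omega sk_j sk_prod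
}.

Definition left_ideal (R : realType) (g : specialKahler R) (I : {vspace g}) :
    Prop :=
  forall x a, a \in I -> sk_prod g x a \in I.

Definition in_kl (R : realType) (V : vectType R) (omega : V -> V -> R)
    (J A : 'End(V)) : Prop :=
  (forall x y, omega (A x) y + omega x (A y) = 0) /\ (A \o J = J \o A)%VF.

(* Lie algebra representations of g with values in kl(h, omega_h, j_h), whose
   bracket is the commutator of endomorphisms. *)
Record kl_rep (R : realType) (g h : specialKahler R) := KlRep {
  kl_rep_hom :> 'Hom(g, 'End(h));
  kl_rep_in_kl : forall x, in_kl (sk_omega h) (sk_j h) (kl_rep_hom x);
  kl_rep_bracket : forall x y,
    kl_rep_hom (lie_bracket g x y) =
    (kl_rep_hom x \o kl_rep_hom y)%VF - (kl_rep_hom y \o kl_rep_hom x)%VF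
}.

Lemma kl_rep_prod (R : realType) (g h : specialKahler R) (rho : kl_rep g h)
    (x y : g) (z : h) :
  rho (sk_prod g x y) z - rho (sk_prod g y x) z =
  rho x (rho y z) - rho y (rho x z).
Proof.
have := congr1 (fun f : 'End(h) => f z) (kl_rep_bracket rho x y).
rewrite (sk_torsion_free (sk_axioms g)) linearB !add_lfunE !opp_lfunE.
by rewrite !comp_lfunE.
Qed.

Definition twisted_compatible (R : realType) (g1 g2 : specialKahler R)
    (theta : kl_rep g1 g2) (rho : kl_rep g2 g1) : Prop :=
  (forall (x1 : g1) (x2 : g2) (y1 : g1),
     sk_prod g1 x1 (rho x2 y1) - rho x2 (sk_prod g1 x1 y1) =
     rho (theta x1 x2) y1 - sk_prod g1 (rho x2 x1) y1) /\
  (forall (x1 : g1) (x2 : g2) (y2 : g2),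
     sk_prod g2 x2 (theta x1 y2) - theta x1 (sk_prod g2 x2 y2) =
     theta (rho x2 x1) y2 - sk_prod g2 (theta x1 x2) y2).

Lemma eq_coord_vbasis (R : realType) (V : vectType R) (x y : V) :
  (forall i, coord (vbasis fullv) i x = coord (vbasis fullv) i y) -> x = y.
Proof.
move=> e; rewrite (coord_vbasis (memvf x)) (coord_vbasis (memvf y)).
by apply: eq_bigr => i _; rewrite e.
Qed.

(* Linear arithmetic in a vectType: proves H1 -> ... -> Hn -> A = B when the
   equation A = B is a linear consequence of the equations Hi. *)
Ltac vect_lra :=
  intros; apply: eq_coord_vbasis; let i := fresh "i" in intro i;
  repeat match goal with H : @eq _ _ _ |- _ =>
    move: (congr1 (coord (vbasis fullv) i) H); clear H end;
  rewrite !(linearD, linearN, linear0) /=; lra.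

Section TwistedProduct.
Variables (R : realType) (g1 g2 : specialKahler R).
Variables (theta : kl_rep g1 g2) (rho : kl_rep g2 g1).
Hypothesis compat : twisted_compatible theta rho.

Local Notation V := (g1 * g2)%type.

Definition tw_prod (x y : V) : V :=
  (sk_prod g1 x.1 y.1 + rho x.2 y.1, theta x.1 y.2 + sk_prod g2 x.2 y.2).

Definition tw_bracket (x y : V) : V := tw_prod x y - tw_prod y x.

Definition tw_omega (x y : V) : R :=
  sk_omega g1 x.1 y.1 + sk_omega g2 x.2 y.2.

Definition tw_j_fun (x : V) : V := (sk_j g1 x.1, sk_j g2 x.2).

Lemma tw_prod_bilinear : bilinear_for *:%R *:%R tw_prod.
Proof.
split=> u a x y; rewrite /tw_prod; congr pair => /=.
- by rewrite linearPl linearP add_lfunE scale_lfunE scalerDr addrACA.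
- by rewrite linearPl linearP add_lfunE scale_lfunE scalerDr addrACA.
- by rewrite linearPr linearP scalerDr addrACA.
- by rewrite linearPr linearP scalerDr addrACA.
Qed.

HB.instance Definition _ :=
  bilinear_isBilinear.Build R V V V _ _ tw_prod tw_prod_bilinear.

Lemma tw_bracket_bilinear : bilinear_for *:%R *:%R tw_bracket.
Proof.
by split=> u a x y; rewrite /tw_bracket linearPl linearPr /= scalerBr opprD
  addrACA.
Qed.

HB.instance Definition _ :=
  bilinear_isBilinear.Build R V V V _ _ tw_bracket tw_bracket_bilinear.

Lemma tw_bracketxx x : tw_bracket x x = 0.
Proof. exact: subrr. Qed.

Lemma tw_prod_left_symmetric x y z :
  tw_prod x (tw_prod y z) - tw_prod (tw_prod x y) z =
  tw_prod y (tw_prod x z) - tw_prod (tw_prod y x) z.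
Proof.
case: x y z => [x1 x2] [y1 y2] [z1 z2]; case: compat => c1 c2.
congr pair => /=.
- have e0 := sk_left_symmetric (sk_axioms g1) x1 y1 z1.
  have e1 := c1 x1 y2 z1; have e2 := c1 y1 x2 z1.
  have e3 := kl_rep_prod rho x2 y2 z1.
  move: e0 e1 e2 e3; rewrite !(linearDl, linearDr, linearD, add_lfunE) /=.
  vect_lra.
- have e0 := sk_left_symmetric (sk_axioms g2) x2 y2 z2.
  have e1 := c2 x1 y2 z2; have e2 := c2 y1 x2 z2.
  have e3 := kl_rep_prod theta x1 y1 z2.
  move: e0 e1 e2 e3; rewrite !(linearDl, linearDr, linearD, add_lfunE) /=.
  vect_lra.
Qed.

Lemma tw_jacobi x y z :
  tw_bracket x (tw_bracket y z) + tw_bracket y (tw_bracket z x)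
    + tw_bracket z (tw_bracket x y) = 0.
Proof.
have := tw_prod_left_symmetric x y z.
have := tw_prod_left_symmetric y z x.
have := tw_prod_left_symmetric z x y.
rewrite /tw_bracket !(linearBl, linearBr) /=.
vect_lra.
Qed.

Definition tw_lie : lieAlgebra R :=
  @LieAlgebra R V tw_bracket tw_bracketxx tw_jacobi.

Lemma tw_omega_bilinear : bilinear_for *%R (idfun \; *%R) tw_omega.
Proof.
split=> u a x y; rewrite /tw_omega /=.
- by rewrite !linearPl /= mulrDr addrACA.
- by rewrite !linearPr /= mulrDr addrACA.
Qed.

Lemma tw_omega_skew x y : tw_omega x y = (-1) ^+ true * idfun (tw_omega y x).
Proof.
rewrite /tw_omega /= (hermitian_subproof x.1) (hermitian_subproof x.2) /=.
by rewrite mulrDr.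
Qed.

HB.instance Definition _ :=
  bilinear_isBilinear.Build R V V R _ _ tw_omega tw_omega_bilinear.
HB.instance Definition _ :=
  isHermitianSesquilinear.Build R V true idfun tw_omega tw_omega_skew.

Lemma tw_j_linear : linear tw_j_fun.
Proof. by move=> a x y; rewrite /tw_j_fun !linearP. Qed.

HB.instance Definition _ := GRing.isLinear.Build R V V _ tw_j_fun tw_j_linear.

Definition tw_j : 'End(V) := linfun tw_j_fun.

Lemma tw_jE x : tw_j x = (sk_j g1 x.1, sk_j g2 x.2).
Proof. by rewrite /tw_j lfunE. Qed.

Lemma tw_jK x : tw_j (tw_j x) = - x.
Proof.
by rewrite !tw_jE /= (sk_complex (sk_axioms g1)).1 (sk_complex (sk_axioms g2)).1.
Qed.

Lemma tw_special x y :
  tw_j (tw_bracket x y) = tw_prod x (tw_j y) - tw_prod y (tw_j x).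
Proof.
case: x y => [x1 x2] [y1 y2]; rewrite !tw_jE; congr pair => /=.
- have := sk_special (sk_axioms g1) x1 y1.
  have jrho z2 z1 : rho z2 (sk_j g1 z1) = sk_j g1 (rho z2 z1).
    have := congr1 (fun f : 'End(g1) => f z1) (kl_rep_in_kl rho z2).2.
    by rewrite !comp_lfunE.
  rewrite (sk_torsion_free (sk_axioms g1)) !jrho !linearB !linearD.
  vect_lra.
- have := sk_special (sk_axioms g2) x2 y2.
  have jtheta z1 z2 : theta z1 (sk_j g2 z2) = sk_j g2 (theta z1 z2).
    have := congr1 (fun f : 'End(g2) => f z2) (kl_rep_in_kl theta z1).2.
    by rewrite !comp_lfunE.
  rewrite (sk_torsion_free (sk_axioms g2)) !jtheta !linearB !linearD.
  vect_lra.
Qed.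

Lemma tw_omega_parallel x y z :
  tw_omega (tw_prod x y) z + tw_omega y (tw_prod x z) = 0.
Proof.
case: x y z => [x1 x2] [y1 y2] [z1 z2]; rewrite /tw_omega /=.
have := sk_omega_parallel (sk_axioms g1) x1 y1 z1.
have := sk_omega_parallel (sk_axioms g2) x2 y2 z2.
have := (kl_rep_in_kl rho x2).1 y1 z1.
have := (kl_rep_in_kl theta x1).1 y2 z2.
rewrite !(linearDl, linearDr) /=; lra.
Qed.

Lemma tw_cocycle x y z :
  tw_omega (tw_bracket x y) z + tw_omega (tw_bracket y z) x
    + tw_omega (tw_bracket z x) y = 0.
Proof.
have skew u v : tw_omega u v = - tw_omega v u.
  by rewrite tw_omega_skew /= expr1 mulN1r.
have := tw_omega_parallel x y z; have := tw_omega_parallel y z x.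
have := tw_omega_parallel z x y.
rewrite (skew y) (skew z (tw_prod y x)) (skew x) /tw_bracket !linearBl /=.
lra.
Qed.

Lemma tw_integrable x y :
  tw_bracket (tw_j x) (tw_j y) - tw_bracket x y =
  tw_j (tw_bracket (tw_j x) y) + tw_j (tw_bracket x (tw_j y)).
Proof.
rewrite !tw_special !tw_jK /tw_bracket !linearNr /=.
vect_lra.
Qed.

Lemma tw_nondegenerate (b : V -> V -> R) (b1 : g1 -> g1 -> R)
    (b2 : g2 -> g2 -> R) :
  (forall x y, b x y = b1 x.1 y.1 + b2 x.2 y.2) ->
  (forall x, b1 x 0 = 0) -> (forall x, b2 x 0 = 0) ->
  nondegenerate_on b1 fullv -> nondegenerate_on b2 fullv ->
  nondegenerate_on b fullv.
Proof.
move=> bE b10 b20 nd1 nd2 [x1 x2] _ x0; congr pair.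
- apply: nd1 => [|y _]; first exact: memvf.
  by have := x0 (y, 0) (memvf _); rewrite bE b20 addr0.
- apply: nd2 => [|y _]; first exact: memvf.
  by have := x0 (0, y) (memvf _); rewrite bE b10 add0r.
Qed.

Lemma tw_is_special_kahler :
  @is_special_kahler R tw_lie tw_omega tw_j tw_prod.
Proof.
split.
- apply: (@tw_nondegenerate _ (sk_omega g1) (sk_omega g2)) => //.
  + by move=> x; rewrite linear0r.
  + by move=> x; rewrite linear0r.
  + exact: sk_omega_nondeg (sk_axioms g1).
  + exact: sk_omega_nondeg (sk_axioms g2).
- exact: tw_cocycle.
- by split; [exact: tw_jK | exact: tw_integrable].
- exact: tw_prod_left_symmetric.
- move=> x y; rewrite !tw_jE /= /tw_omega /=.
  by rewrite (sk_metric_sym (sk_axioms g1)) (sk_metric_sym (sk_axioms g2)).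
- apply: (@tw_nondegenerate _ (fun x y => sk_omega g1 x (sk_j g1 y))
    (fun x y => sk_omega g2 x (sk_j g2 y))).
  + by move=> x y; rewrite tw_jE.
  + by move=> x; rewrite !linear0.
  + by move=> x; rewrite !linear0.
  + exact: sk_metric_nondeg (sk_axioms g1).
  + exact: sk_metric_nondeg (sk_axioms g2).
- by [].
- exact: tw_omega_parallel.
- exact: tw_special.
Qed.

Definition twisted_product : specialKahler R :=
  @SpecialKahler R tw_lie tw_omega tw_j tw_prod tw_is_special_kahler.

End TwistedProduct.

Record is_sk_isomorphism (R : realType) (g h : specialKahler R)
    (f : 'Hom(g, h)) : Prop := IsSkIsomorphism {
  sk_iso_bij : bijective f;
  sk_iso_bracket : forall x y, f (lie_bracket g x y) = lie_bracket h (f x) (f y);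
  sk_iso_prod : forall x y, f (sk_prod g x y) = sk_prod h (f x) (f y);
  sk_iso_omega : forall x y, sk_omega h (f x) (f y) = sk_omega g x y;
  sk_iso_j : forall x, f (sk_j g x) = sk_j h (f x)
}.

(* Main.v *)
Require Import Defs.
From HB Require Import structures.
From mathcomp Require Import all_boot all_order all_algebra.
From mathcomp Require Import reals lra.
Local Open Scope ring_scope.

Set Implicit Arguments.
Unset Strict Implicit.
Unset Printing Implicit Defensive.

Import GRing.Theory.

(** The second factor is the omega-orthogonal complement W of I.  Since the
    form is non-degenerate on I, the intersection of I and W is 0, and a
    dimension count gives g = I + W.  The compatibility conditions make W an
    ideal of the same kind as I: left multiplications are omega-skew, so they
    preserve the orthogonal of a left ideal; j is omega-skew as well, because
    omega(x, j y) is symmetric; and the form is non-degenerate on W because it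
    is so on I + W and vanishes on W x I (orthov_ideal).

    Each of the two ideals is a special Kähler Lie algebra by restriction
    (ideal_sk), and each acts on the other one by left multiplication.  Left
    symmetry of the product together with torsion-freeness says that left
    multiplication is a representation of g, and it is omega-skew.  A left
    multiplication of g need not commute with j, but the cross actions do: by
    the identity j[w, u] = w.(j u) - u.(j w), the defect w.(j u) - j(w.u) lies
    in I when u does, and equals u.(j w) - j(u.w), which lies in W when w does;
    hence it is 0 (prod_j_disjoint).  So both actions take values in kl
    (action_rep).

    The two compatibility conditions of a twisted product are the left symmetry
    of the product for one element in I and one in W, and the isomorphism is
    the addition map from I x W to g, which sends I x 0 onto I. *)

(** * Orthogonal complements in finite dimension *)

Section Orthogonal.
Variables (F : fieldType) (eps : bool) (theta : {rmorphism F -> F}).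
Variables (V : vectType F) (form : {hermitian V for eps & theta}).
Variable U : {vspace V}.

(** The functional that x induces on U, in coordinates: its kernel is the
    orthogonal of U and its range has dimension at most that of U, which bounds
    the dimension of the orthogonal from below. *)
Definition vbasis_pairing (x : V) : 'rV[F]_(\dim U) :=
  \row_i form x (vbasis U)`_i.

Lemma vbasis_pairing_linear : linear vbasis_pairing.
Proof. by move=> a x y; apply/rowP => i; rewrite !mxE linearPl. Qed.

HB.instance Definition _ :=
  GRing.isLinear.Build F V 'rV[F]_(\dim U) _ vbasis_pairing
    vbasis_pairing_linear.

Lemma lker_vbasis_pairing : (lker (linfun vbasis_pairing) <= orthov form U)%VS.
Proof.
apply/subvP => x; rewrite memv_ker lfunE /= => /eqP x0.
apply/mem_orthovP => v /coord_vbasis ->.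
rewrite linear_sumr big1 // => i _; rewrite linearZr /=.
by have /rowP/(_ i) := x0; rewrite !mxE => ->; rewrite mulr0.
Qed.

(** The orthogonal of U has dimension at least the codimension of U, so it is a
    complement of U as soon as it is disjoint from U. *)
Lemma addv_orthov :
  (U :&: orthov form U = 0)%VS -> (U + orthov form U = fullv)%VS.
Proof.
move=> UW0; apply/eqP; rewrite eqEdim subvf /= dimv_disjoint_sum //.
have <- := limg_ker_dim (linfun vbasis_pairing) fullv.
rewrite capfv addnC leq_add //; last exact/dimvS/lker_vbasis_pairing.
by rewrite (leq_trans (dimvS (subvf _))) // dimvf /dim /= mul1n.
Qed.

End Orthogonal.

(** * Restriction of a special Kähler structure to a left ideal *)

Record kahler_left_ideal (R : realType) (g : specialKahler R)
    (U : {vspace g}) : Prop := KahlerLeftIdeal {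
  kli_left : left_ideal U;
  kli_j : forall x, x \in U -> sk_j g x \in U;
  kli_nondeg : nondegenerate_on (sk_omega g) U
}.

Section LeftIdeal.
Variables (R : realType) (g : specialKahler R) (U : {vspace g}).
Local Notation S := (subvs_of U).
Local Notation ax := (sk_axioms g).

(** The projection onto U only serves to land in the subtype: each of the values
    projected below lies in U already when U is a left ideal stable under j.
    Using it makes the operations bilinear for an arbitrary subspace U. *)
Definition ideal_bracket (x y : S) : S :=
  vsproj U (lie_bracket g (vsval x) (vsval y)).
Definition ideal_prod (x y : S) : S :=
  vsproj U (sk_prod g (vsval x) (vsval y)).
Definition ideal_omega (x y : S) : R := sk_omega g (vsval x) (vsval y).
Definition ideal_j : 'End(S) :=
  linfun (vsproj U \o sk_j g \o @vsval _ _ U).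

Lemma ideal_bracket_bilinear : bilinear_for *:%R *:%R ideal_bracket.
Proof.
by split=> u a x y; rewrite /ideal_bracket linearP ?linearPl ?linearPr linearP.
Qed.

HB.instance Definition _ :=
  bilinear_isBilinear.Build R S S S _ _ ideal_bracket ideal_bracket_bilinear.

Lemma ideal_prod_bilinear : bilinear_for *:%R *:%R ideal_prod.
Proof.
by split=> u a x y; rewrite /ideal_prod linearP ?linearPl ?linearPr linearP.
Qed.

HB.instance Definition _ :=
  bilinear_isBilinear.Build R S S S _ _ ideal_prod ideal_prod_bilinear.

Lemma ideal_omega_bilinear : bilinear_for *%R (idfun \; *%R) ideal_omega.
Proof.
by split=> u a x y; rewrite /ideal_omega linearP ?linearPl ?linearPr.
Qed.

Lemma ideal_omega_skew x y :
  ideal_omega x y = (-1) ^+ true * idfun (ideal_omega y x).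
Proof. exact: hermitian_subproof. Qed.

HB.instance Definition _ :=
  bilinear_isBilinear.Build R S S R _ _ ideal_omega ideal_omega_bilinear.
HB.instance Definition _ :=
  isHermitianSesquilinear.Build R S true idfun ideal_omega ideal_omega_skew.

Hypothesis kU : kahler_left_ideal U.

Lemma vsval_ideal_prod x y :
  vsval (ideal_prod x y) = sk_prod g (vsval x) (vsval y).
Proof. by rewrite vsprojK ?(kli_left kU) ?subvsP. Qed.

(** A left ideal is a Lie subalgebra, the bracket being the commutator of the
    product. *)
Lemma vsval_ideal_bracket x y :
  vsval (ideal_bracket x y) = lie_bracket g (vsval x) (vsval y).
Proof.
by rewrite vsprojK // (sk_torsion_free ax) rpredB ?(kli_left kU) ?subvsP.
Qed.

Lemma vsval_ideal_j x : vsval (ideal_j x) = sk_j g (vsval x).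
Proof. by rewrite lfunE /= vsprojK ?(kli_j kU) ?subvsP. Qed.

Lemma ideal_bracketxx x : ideal_bracket x x = 0.
Proof. by rewrite /ideal_bracket lie_bracketxx linear0. Qed.

Lemma ideal_jacobi x y z :
  ideal_bracket x (ideal_bracket y z) + ideal_bracket y (ideal_bracket z x)
    + ideal_bracket z (ideal_bracket x y) = 0.
Proof.
apply: subvs_inj; rewrite !linearD /= !vsval_ideal_bracket.
exact: lie_jacobi.
Qed.

Definition ideal_lie : lieAlgebra R :=
  @LieAlgebra R S ideal_bracket ideal_bracketxx ideal_jacobi.

Lemma ideal_omega_nondeg (x : S) : (forall y, ideal_omega x y = 0) -> x = 0.
Proof.
move=> x0; apply: subvs_inj; rewrite linear0.
apply: (kli_nondeg kU) (subvsP x) _ => y yU.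
by have := x0 (vsproj U y); rewrite /ideal_omega vsprojK.
Qed.

Lemma ideal_is_special_kahler :
  @is_special_kahler R ideal_lie ideal_omega ideal_j ideal_prod.
Proof.
split.
- by move=> x _ x0; apply: ideal_omega_nondeg => y; apply: x0; apply: memvf.
- by move=> x y z; rewrite /= /ideal_omega !vsval_ideal_bracket (sk_cocycle ax).
- have [jK jN] := sk_complex ax; split=> [x|x y]; apply: subvs_inj.
    by rewrite !vsval_ideal_j jK linearN.
  rewrite !linearD linearN /= !(vsval_ideal_j, vsval_ideal_bracket).
  exact: jN.
- move=> x y z; apply: subvs_inj; rewrite !linearB /= !vsval_ideal_prod.
  exact: sk_left_symmetric ax _ _ _.
- move=> x y; rewrite /= /ideal_omega !vsval_ideal_j.
  exact: sk_metric_sym ax _ _.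
- move=> x _ x0; apply: ideal_omega_nondeg => y.
  (* - j is the inverse of j, so that x is tested against every y. *)
  have := x0 (- ideal_j y) (memvf _); rewrite /= /ideal_omega.
  rewrite !(vsval_ideal_j, linearN) /= vsval_ideal_j.
  by rewrite (sk_complex ax).1 linearN opprK.
- move=> x y; apply: subvs_inj; rewrite linearB /= !vsval_ideal_prod.
  by rewrite vsval_ideal_bracket (sk_torsion_free ax).
- move=> x y z; rewrite /= /ideal_omega !vsval_ideal_prod.
  exact: sk_omega_parallel ax _ _ _.
- move=> x y; apply: subvs_inj; rewrite linearB /= !vsval_ideal_prod.
  by rewrite !vsval_ideal_j vsval_ideal_bracket (sk_special ax).
Qed.

Definition ideal_sk : specialKahler R :=
  @SpecialKahler R ideal_lie ideal_omega ideal_j ideal_prod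
    ideal_is_special_kahler.

End LeftIdeal.

(** * Action of one ideal on another by left multiplication *)

Section Action.
Variables (R : realType) (g : specialKahler R) (U W : {vspace g}).
Hypotheses (kU : kahler_left_ideal U) (kW : kahler_left_ideal W).
Hypothesis UW0 : (U :&: W = 0)%VS.
Local Notation ax := (sk_axioms g).

(** The identity j[w, u] = w.(j u) - u.(j w) equates a vector of U, the defect
    of commutation of j with the left multiplication by w, with a vector of W. *)
Lemma prod_j_disjoint w u : w \in W -> u \in U ->
  sk_prod g w (sk_j g u) = sk_j g (sk_prod g w u).
Proof.
move=> wW uU; apply/eqP; rewrite -subr_eq0 -memv0 -UW0 memv_cap.
have e : sk_prod g w (sk_j g u) - sk_j g (sk_prod g w u) =
    sk_prod g u (sk_j g w) - sk_j g (sk_prod g u w).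
  have := sk_special ax w u; rewrite (sk_torsion_free ax) linearB /=.
  by vect_lra.
apply/andP; split; last rewrite e.
  by rewrite rpredB ?(kli_j kU) ?(kli_left kU) ?(kli_j kU).
by rewrite rpredB ?(kli_j kW) ?(kli_left kW) ?(kli_j kW).
Qed.

Definition action_fun (w : subvs_of W) (u : subvs_of U) : subvs_of U :=
  vsproj U (sk_prod g (vsval w) (vsval u)).

Lemma action_fun_linear w : linear (action_fun w).
Proof. by move=> a x y; rewrite /action_fun !linearP. Qed.

HB.instance Definition _ w :=
  GRing.isLinear.Build R (subvs_of U) (subvs_of U) _ (action_fun w)
    (action_fun_linear w).

Definition action_end (w : subvs_of W) : 'End(subvs_of U) :=
  linfun (action_fun w).

Lemma vsval_action_end w u :
  vsval (action_end w u) = sk_prod g (vsval w) (vsval u).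
Proof. by rewrite lfunE vsprojK ?(kli_left kU) ?subvsP. Qed.

Lemma action_end_linear : linear action_end.
Proof.
move=> a w w'; apply/lfunP => u; apply: subvs_inj.
rewrite add_lfunE scale_lfunE linearP /= !vsval_action_end.
by rewrite linearP linearPl.
Qed.

HB.instance Definition _ :=
  GRing.isLinear.Build R (subvs_of W) 'End(subvs_of U) _ action_end
    action_end_linear.

Definition action_hom : 'Hom(ideal_sk kW, 'End(ideal_sk kU)) :=
  linfun action_end.

Lemma vsval_action_hom w u :
  vsval (action_hom w u) = sk_prod g (vsval w) (vsval u).
Proof. by rewrite lfunE vsval_action_end. Qed.

Lemma action_in_kl w :
  in_kl (sk_omega (ideal_sk kU)) (sk_j (ideal_sk kU)) (action_hom w).
Proof.
split=> [x y|].
  rewrite /= /ideal_omega !vsval_action_hom.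
  exact: sk_omega_parallel ax _ _ _.
apply/lfunP => u; apply: subvs_inj; rewrite !comp_lfunE.
rewrite vsval_action_hom !(vsval_ideal_j kU) vsval_action_hom.
by rewrite prod_j_disjoint ?subvsP.
Qed.

(** Left multiplication is a representation of the commutator Lie algebra of any
    left symmetric product. *)
Lemma action_bracket x y :
  action_hom (lie_bracket (ideal_sk kW) x y) =
  (action_hom x \o action_hom y)%VF - (action_hom y \o action_hom x)%VF.
Proof.
apply/lfunP => u; apply: subvs_inj.
rewrite add_lfunE opp_lfunE !comp_lfunE linearB /= !vsval_action_hom.
rewrite (vsval_ideal_bracket kW) (sk_torsion_free ax) linearBl /=.
have := sk_left_symmetric ax (vsval x) (vsval y) (vsval u).
by vect_lra.
Qed.

Definition action_rep : kl_rep (ideal_sk kW) (ideal_sk kU) :=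
  KlRep action_in_kl action_bracket.

End Action.

(** * Orthogonal decomposition into two ideals *)

Section Decomposition.
Variables (R : realType) (g : specialKahler R) (U W : {vspace g}).
Hypotheses (kU : kahler_left_ideal U) (kW : kahler_left_ideal W).
Hypothesis UW0 : (U :&: W = 0)%VS.
Hypothesis UWf : (U + W = fullv)%VS.
Hypothesis UWorth : forall u w, u \in U -> w \in W -> sk_omega g u w = 0.
Local Notation ax := (sk_axioms g).

Let WU0 : (W :&: U = 0)%VS. Proof. by rewrite capvC. Qed.
Let rho := action_rep kU kW UW0.
Let theta := action_rep kW kU WU0.

(** Both conditions are left symmetry for x1 in U and x2 in W, applied to a
    vector of U for the first one and of W for the second one. *)
Lemma action_compatible : twisted_compatible theta rho.
Proof.
split=> x1 x2 y; apply: subvs_inj; rewrite !linearB /=.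
  rewrite !(vsval_ideal_prod kU, vsval_action_hom).
  have := sk_left_symmetric ax (vsval x1) (vsval x2) (vsval y).
  by vect_lra.
rewrite !(vsval_ideal_prod kW, vsval_action_hom).
have := sk_left_symmetric ax (vsval x1) (vsval x2) (vsval y).
by vect_lra.
Qed.

Local Notation tw := (twisted_product action_compatible).

Definition recombine (x : subvs_of U * subvs_of W) : g :=
  vsval x.1 + vsval x.2.

Lemma recombine_linear : linear recombine.
Proof. by move=> a x y; rewrite /recombine !linearP /= scalerDr addrACA. Qed.

HB.instance Definition _ :=
  GRing.isLinear.Build R (subvs_of U * subvs_of W)%type g _ recombine
    recombine_linear.

Definition recombine_hom : 'Hom(tw, g) := linfun recombine.

Lemma recombine_homE (x : tw) : recombine_hom x = vsval x.1 + vsval x.2.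
Proof. by rewrite lfunE. Qed.

Lemma recombine_bij : bijective recombine_hom.
Proof.
have ker0 : lker recombine_hom == 0%VS.
  rewrite -subv0; apply/subvP => -[x1 x2].
  rewrite memv_ker memv0 recombine_homE /= addr_eq0 => /eqP e.
  have x10 : vsval x1 = 0.
    apply/eqP; rewrite -memv0 -UW0 memv_cap subvsP /=.
    by rewrite e rpredN subvsP.
  have x20 : vsval x2 = 0 by apply/eqP; rewrite -oppr_eq0 -e x10.
  by apply/eqP; congr pair; apply: subvs_inj; rewrite linear0.
exists (recombine_hom^-1)%VF; first exact: lker0_lfunK.
move=> x; apply: limg_lfunVK; apply/memv_imgP.
have /memv_addP[u uU [w wW ->]] : x \in (U + W)%VS by rewrite UWf memvf.
exists ((vsproj U u, vsproj W w) : tw); first exact: memvf.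
by rewrite recombine_homE /= !vsprojK.
Qed.

Lemma recombine_prod x y :
  recombine_hom (sk_prod tw x y) = sk_prod g (recombine_hom x) (recombine_hom y).
Proof.
rewrite !recombine_homE /= !linearD /= !vsval_action_hom.
rewrite (vsval_ideal_prod kU) (vsval_ideal_prod kW) !(linearDl, linearDr) /=.
by vect_lra.
Qed.

Lemma recombine_is_iso : is_sk_isomorphism recombine_hom.
Proof.
split.
- exact: recombine_bij.
- move=> x y; rewrite (sk_torsion_free (sk_axioms tw)) (sk_torsion_free ax).
  by rewrite linearB -!recombine_prod.
- exact: recombine_prod.
- move=> [x1 x2] [y1 y2]; rewrite !recombine_homE /= /tw_omega /= /ideal_omega.
  have skew x y : sk_omega g x y = - sk_omega g y x.
    by rewrite (hermitian_subproof x) /= expr1 mulN1r.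
  rewrite !(linearDl, linearDr) /= [sk_omega g (vsval x2) (vsval y1)]skew.
  rewrite (UWorth (subvsP x1) (subvsP y2)) (UWorth (subvsP y1) (subvsP x2)).
  by rewrite oppr0 addr0 add0r.
- move=> x; rewrite !recombine_homE.
  rewrite (tw_jE x : sk_j tw x = _) /= linearD /=.
  by rewrite (vsval_ideal_j kU) (vsval_ideal_j kW).
Qed.

Lemma mem_recombine a : a \in U <->
  exists x1 : ideal_sk kU, recombine_hom (x1, 0) = a.
Proof.
split=> [aU|[x1 <-]]; last by rewrite recombine_homE /= addr0 subvsP.
by exists (vsproj U a); rewrite recombine_homE /= addr0 vsprojK.
Qed.

End Decomposition.

(** * The orthogonal complement of an ideal *)

Section OrthogonalIdeal.
Variables (R : realType) (g : specialKahler R) (U : {vspace g}).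
Hypothesis kU : kahler_left_ideal U.
Local Notation W := (orthov (sk_omega g) U).
Local Notation ax := (sk_axioms g).

Lemma capv_orthov_ideal : (U :&: W = 0)%VS.
Proof.
apply/eqP; rewrite -subv0; apply/subvP => x; rewrite memv_cap memv0.
case/andP=> xU /mem_orthovP xW.
by apply/eqP; apply: kli_nondeg kU _ xU _ => y; apply: xW.
Qed.

Lemma addv_orthov_ideal : (U + W = fullv)%VS.
Proof. exact/addv_orthov/capv_orthov_ideal. Qed.

(** Stability of W holds because the left multiplications and j are skew for
    omega and preserve U.  A vector of W orthogonal to W is orthogonal to
    U + W, the whole of g, hence it is 0. *)
Lemma orthov_ideal : kahler_left_ideal W.
Proof.
split=> [x b /mem_orthovP bW | b /mem_orthovP bW | b bW b0].
- apply/mem_orthovP => a aU; have := sk_omega_parallel ax x b a.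
  by rewrite bW ?(kli_left kU) // addr0.
- apply/mem_orthovP => a aU.
  rewrite (hermitian_subproof (sk_j g b)) /= (sk_metric_sym ax).
  by rewrite bW ?mulr0 // (kli_j kU).
- apply: (sk_omega_nondeg ax) (memvf b) _ => y _.
  have /memv_addP[u uU [w wW ->]] : y \in (U + W)%VS.
    by rewrite addv_orthov_ideal memvf.
  by rewrite linearDr /= (mem_orthovP bW) // b0 // addr0.
Qed.

Lemma omega_orthov u w : u \in U -> w \in W -> sk_omega g u w = 0.
Proof.
by move=> uU /mem_orthovP wW; rewrite (hermitian_subproof u) /= wW ?mulr0.
Qed.

End OrthogonalIdeal.

(* The last clause says that f carries the factor g1 onto I.  Without it, I would
   not occur in the conclusion, and g1 = g, g2 = 0 would be a witness. *)
Theorem theorem4p6 (R : realType) (g : specialKahler R) (I : {vspace g})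
  (I_left_ideal : left_ideal I)
  (I_complex : (sk_j g @: I)%VS = I)
  (I_nondegenerate : nondegenerate_on (sk_omega g) I) :
  exists (g1 g2 : specialKahler R) (theta : kl_rep g1 g2) (rho : kl_rep g2 g1)
    (compat : twisted_compatible theta rho)
    (f : 'Hom(twisted_product compat, g)),
    is_sk_isomorphism f /\
    (forall a : g, a \in I <-> exists x1 : g1, f (x1, 0) = a).
Proof.
have kI : kahler_left_ideal I.
  by split=> // x xI; rewrite -I_complex memv_img.
have I0 := capv_orthov_ideal kI.
exists (ideal_sk kI), (ideal_sk (orthov_ideal kI)); do 2 eexists.
exists (action_compatible kI (orthov_ideal kI) I0).
exists (recombine_hom kI (orthov_ideal kI) I0); split.
  by apply: recombine_is_iso; [exact: addv_orthov_ideal | exact: omega_orthov].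
exact: mem_recombine.
Qed.
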